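(* Let $G$ be a group. Then the enhanced power graph $\mathrm{EPow}(G)$ and the commuting graph $\mathrm{Com}(G)$ are equal if and only if $G$ has no subgroup isomorphic to $\mathbb{Z}\times\mathbb{Z}$ and, for every prime $p$, no subgroup isomorphic to $\mathbb{Z}\times C_p$ or $C_p\times C_p$.
   Context: All graphs are undirected and simple. $G$ is an arbitrary (finite or infinite) group. $\mathrm{EPow}(G)$ is the graph with vertex set $G$ in which two distinct vertices $x,y$ are adjacent if the subgroup $\langle x,y\rangle$ is cyclic. $\mathrm{Com}(G)$ is the graph with vertex set $G$ in which two distinct vertices $x,y$ are adjacent if $xy=yx$. Equality of two graphs on the vertex set $G$ means that they have the same edge set. $C_n$ denotes the cyclic group of order $n$. *)

(* Defs.v *)
From HB Require Import structures.
From mathcomp Require Import all_boot all_order all_fingroup all_algebra.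
From mathcomp Require Import boolp classical_sets.

Set Implicit Arguments.
Unset Strict Implicit.
Unset Printing Implicit Defensive.

Local Open Scope classical_set_scope.
Local Open Scope group_scope.

Record sgraph (V : Type) := SGraph {
  adj : V -> V -> Prop;
  adj_sym : forall x y, adj x y -> adj y x;
  adj_irrefl : forall x, ~ adj x x }.

Definition edges (V : Type) (X : sgraph V) : set (set V) :=
  [set e | exists x y, adj X x y /\ e = [set x; y]].

(* Subgroups are classical sets, since a subgroup of an arbitrary group need
   not be decidable; the library's [group_closed] is about boolean predicates. *)
Definition is_subgroup (G : groupType) (H : set G) : Prop :=
  [/\ H 1, forall x y, H x -> H y -> H (x * y) & forall x, H x -> H x^-1].

Definition generated (G : groupType) (A : set G) : set G :=
  smallest (@is_subgroup G) A.

Definition is_cyclic (G : groupType) (H : set G) : Prop :=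
  exists g : G, H = generated [set g].

Definition epow_adj (G : groupType) (x y : G) : Prop :=
  x <> y /\ is_cyclic (generated [set x; y]).

Definition com_adj (G : groupType) (x y : G) : Prop :=
  x <> y /\ commute x y.

Lemma epow_adj_sym (G : groupType) (x y : G) : epow_adj x y -> epow_adj y x.
Proof. by case=> nxy; rewrite setUC => cxy; split=> // /esym. Qed.

Lemma epow_adj_irrefl (G : groupType) (x : G) : ~ epow_adj x x.
Proof. by case. Qed.

Lemma com_adj_sym (G : groupType) (x y : G) : com_adj x y -> com_adj y x.
Proof. by case=> nxy cxy; split=> // /esym. Qed.

Lemma com_adj_irrefl (G : groupType) (x : G) : ~ com_adj x x.
Proof. by case. Qed.

Definition EPow (G : groupType) : sgraph G :=
  SGraph (@epow_adj_sym G) (@epow_adj_irrefl G).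

Definition Com (G : groupType) : sgraph G :=
  SGraph (@com_adj_sym G) (@com_adj_irrefl G).

Definition isomorphic_to (G : groupType) (H : set G) (K : groupType) : Prop :=
  exists f : K -> G,
    [/\ {morph f : x y / x * y}, injective f & range f = H].

Definition has_subgroup_isomorphic_to (G K : groupType) : Prop :=
  exists H : set G, is_subgroup H /\ isomorphic_to H K.

Definition Zgrp : groupType := Algebra.to_multiplicative int.

(* 'Z_n is the ring of integers mod n only for n > 1 (it is 'Z_2 otherwise),
   so this is the cyclic group of order n only in that range. *)
Definition Cgrp (n : nat) : groupType := Algebra.to_multiplicative 'Z_n.

(* Main.v *)
From Pilot Require Import Defs.
From HB Require Import structures.
From mathcomp Require Import all_boot all_order all_fingroup all_algebra.
From mathcomp Require Import boolp classical_sets.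

(* Adjacency in EPow(G) implies adjacency in Com(G), so the two graphs agree
   iff any two commuting elements generate a cyclic group.

   If G contains Z/c x Z/d with d | c and d not a unit (d = 0 or d prime here),
   the two generators a, b commute; if a = g^i and b = g^j then a^j = b^i forces
   c | j, so b = g^j = 1 because c kills Z/c x Z/d: a contradiction.

   Conversely let x, y commute. As Z x Z does not embed, the map
   (m, n) |-> x^m y^n has a nonzero kernel vector, and a unimodular change of
   basis gives generators u, v of <x, y> with u^d = 1, d > 0. Choose d minimal;
   then every nontrivial relation u^i v^j = 1 has gcd(i, j) >= d. If d = 1 the
   group is <v>. Otherwise let p | d be prime and w = u^(d/p), of order p and
   not in <v> by minimality. If v has infinite order, <v, w> is Z x C_p. If v
   has finite order e, the relation (d, e) gives d | e, so <w, v^(e/p)> is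
   C_p x C_p. *)

Set Implicit Arguments.
Unset Strict Implicit.
Unset Printing Implicit Defensive.

(* [fingroup.generated] shadows the [generated] of Defs. *)
Import Pilot.Defs.
Import GRing.Theory.

Local Open Scope group_scope.

(** * Integer powers in a group *)

Definition zpow (G : groupType) (x : G) (n : int) : G :=
  match n with Posz m => x ^+ m | Negz m => x ^- m.+1 end.

Section IntegerPowers.
Variable G : groupType.
Implicit Types (x y : G) (m n : int).

Lemma zpow0 x : zpow x 0 = 1. Proof. by []. Qed.

Lemma zpow1 x : zpow x 1 = x. Proof. by []. Qed.

Lemma zpow1n n : zpow (1 : G) n = 1.
Proof. by case: n => n /=; rewrite expg1n ?invg1. Qed.

(** Mixed signs are settled once here, so that [zpowS] holds across zero and the other exponent laws
    follow by induction over the integers. *)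
Lemma zpow_subn x (m n : nat) : zpow x (m%:Z - n%:Z)%R = x ^+ m * x ^- n.
Proof.
have [lenm | ltmn] := leqP n m; first by rewrite subzn //= expgnFr.
rewrite -opprB subzn 1?ltnW //; case def_k: (n - m) => [|k].
  by move: ltmn; rewrite -subn_gt0 def_k.
by rewrite -NegzE /= -def_k expgnFr 1?ltnW // invgF.
Qed.

Lemma zpowS x n : zpow x (n + 1)%R = zpow x n * x.
Proof.
case: n => n; first by rewrite -PoszD addn1 /= expgSr.
rewrite NegzE addrC -[1%R]/(Posz 1) zpow_subn -NegzE expg1.
exact/commuteV/commuteX/commute_refl.
Qed.

Lemma zpowB1 x n : zpow x (n - 1)%R = zpow x n * x^-1.
Proof. by rewrite -{2}[n](subrK 1%R) zpowS mulgK. Qed.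

Lemma zpowD x m n : zpow x (m + n)%R = zpow x m * zpow x n.
Proof.
elim/int_rect: n => [|n IHn|n IHn]; first by rewrite addr0 mulg1.
  by rewrite -addn1 PoszD addrA !zpowS IHn mulgA.
by rewrite -addn1 PoszD opprD addrA !zpowB1 IHn mulgA.
Qed.

Lemma zpowN x n : zpow x (- n)%R = (zpow x n)^-1.
Proof. by apply/esym/mulg1_eq; rewrite -zpowD subrr. Qed.

Lemma zpowM x m n : zpow x (m * n)%R = zpow (zpow x m) n.
Proof.
elim/int_rect: n => [|n IHn|n IHn]; first by rewrite mulr0.
  by rewrite -addn1 PoszD zpowS mulrDr mulr1 zpowD IHn.
by rewrite -addn1 PoszD opprD zpowB1 mulrBr mulr1 zpowD zpowN IHn.
Qed.

Lemma zpow_dvd x m n : (m %| n)%Z -> zpow x m = 1 -> zpow x n = 1.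
Proof. by case/dvdzP=> k -> xm1; rewrite mulrC zpowM xm1 zpow1n. Qed.

Lemma zpow_gcd x m n : zpow x m = 1 -> zpow x n = 1 -> zpow x (gcdz m n) = 1.
Proof.
have [a [b <-]] := Bezoutz m n => xm1 xn1.
by rewrite zpowD ![(_ * m)%R]mulrC ![(_ * n)%R]mulrC !zpowM xm1 xn1 !zpow1n mulg1.
Qed.

(** If [p] did not divide [n], the two exponents would be coprime and [zpow_gcd] would give
    [x = 1]. *)
Lemma zpow_prime x (p : nat) n :
  prime p -> x <> 1 -> zpow x p = 1 -> zpow x n = 1 -> (p %| n)%Z.
Proof.
move=> p_pr x_neq1 xp1 xn1; apply/idPn => p'n.
apply: x_neq1; rewrite -[x]zpow1 -[1%R]/(Posz 1).
suff <-: gcdz p n = 1%N by apply: zpow_gcd.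
by congr Posz; apply/eqP; rewrite -[_ == _]/(coprime p `|n|) prime_coprime.
Qed.

Lemma commute_zpow x y m n : commute x y -> commute (zpow x m) (zpow y n).
Proof.
suff cz (u v : G) k : commute u v -> commute u (zpow v k).
  by move=> cxy; apply/cz/commute_sym/cz/commute_sym.
by case: k => k cuv /=; [|apply: commuteV]; apply: commuteX.
Qed.

Lemma zpowMg x y n : commute x y -> zpow (x * y) n = zpow x n * zpow y n.
Proof.
move=> cxy; case: n => n /=; first exact: expgMn.
by rewrite expgMn // invgM -!expVgn; apply: commuteX2; apply: commuteV;
  apply/commute_sym; apply: commuteV.
Qed.

End IntegerPowers.

Lemma morph_zpow (K G : groupType) (f : K -> G) :
  {morph f : x y / x * y} -> forall x n, f (zpow x n) = zpow (f x) n.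
Proof.
move=> fM x; have f1: f 1 = 1 by apply: (@mulgI _ (f 1)); rewrite -fM !mulg1.
elim/int_rect=> [//|n IHn|n IHn]; first by rewrite -addn1 PoszD !zpowS fM IHn.
rewrite -addn1 PoszD opprD !zpowB1 fM IHn; congr (_ * _).
by apply/esym/mulg1_eq; rewrite -fM mulgV.
Qed.

Local Open Scope classical_set_scope.

(** * Subgroups generated by one or two elements *)

Section GeneratedSubgroups.
Variable G : groupType.
Implicit Types (x y : G) (A H : set G).

Lemma subgroup_zpow H x n : is_subgroup H -> H x -> H (zpow x n).
Proof.
case=> H1 HM HV Hx.
have HX m : H (x ^+ m) by elim: m => // m IHm; rewrite expgS; apply: HM.
by case: n => n /=; [|apply: HV]; apply: HX.
Qed.

Lemma generated_subgroup A : is_subgroup (generated A).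
Proof.
split=> [H [[H1 _ _] _] //|x y Ax Ay H sgH|x Ax H sgH].
  by have [[_ HM _] _] := sgH; apply: HM; [apply: Ax | apply: Ay].
by have [[_ _ HV] _] := sgH; apply: HV; apply: Ax.
Qed.

Lemma generated_sub A H : is_subgroup H -> A `<=` H -> generated A `<=` H.
Proof. by move=> sgH sAH; exact: (@smallest_sub _ (@is_subgroup G) A H). Qed.

Lemma mem_generated A : A `<=` generated A.
Proof. exact: (@sub_gen_smallest _ (@is_subgroup G)). Qed.

Lemma generatedl x y : generated [set x; y] x.
Proof. by apply: (@mem_generated [set x; y]); left. Qed.

Lemma generatedr x y : generated [set x; y] y.
Proof. by apply: (@mem_generated [set x; y]); right. Qed.

Lemma generated_pair_zpow x y m n :
  generated [set x; y] (zpow x m * zpow y n).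
Proof.
have sgH := generated_subgroup [set x; y]; have [_ HM _] := sgH.
by apply: HM; apply: (subgroup_zpow _ sgH); [apply: generatedl | apply: generatedr].
Qed.

Lemma generated1 x : generated [set x] = range (zpow x).
Proof.
apply/seteqP; split=> [|_ [n _ <-]].
  apply: generated_sub => [|_ ->]; last by exists 1%R.
  split; first by exists 0%R.
    by move=> _ _ [m _ <-] [n _ <-]; exists (m + n)%R; rewrite ?zpowD.
  by move=> _ [n _ <-]; exists (- n)%R; rewrite ?zpowN.
by apply: (subgroup_zpow _ (generated_subgroup _)); apply: (@mem_generated [set x]).
Qed.

Lemma eq_generated A B :
  A `<=` generated B -> B `<=` generated A -> generated A = generated B.
Proof.
by move=> sAB sBA; apply/seteqP; split; apply: generated_sub => //;
  apply: generated_subgroup.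
Qed.

Lemma cyclic_commute x y : is_cyclic (generated [set x; y]) -> commute x y.
Proof.
case=> g; rewrite generated1 => def_g.
have := @generatedl x y; have := @generatedr x y.
rewrite def_g => -[n _ <-] [m _ <-]; exact/commute_zpow/commute_refl.
Qed.

End GeneratedSubgroups.

(** * From edge sets to adjacency *)

(** An unordered pair determines its endpoints up to a swap, which [adj_sym] absorbs; irreflexivity
    excludes the degenerate matching in which the endpoints coincide. *)
Lemma edges_adj (V : Type) (X : sgraph V) x y :
  edges X [set x; y] <-> adj X x y.
Proof.
split=> [[a [b [Xab def_ab]]]|]; last by exists x, y.
have: [set a; b] x by rewrite -def_ab; left.
have: [set a; b] y by rewrite -def_ab; right.
have: [set x; y] a by rewrite def_ab; left.
have: [set x; y] b by rewrite def_ab; right.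
have nab: a <> b by move=> eab; rewrite eab in Xab; apply: (adj_irrefl Xab).
by move=> /= [] eb [] ea [] ey [] ex; subst=> //; apply: adj_sym.
Qed.

Lemma edges_EPow_ComP (G : groupType) :
  edges (EPow G) = edges (Com G) <->
  forall x y : G, x <> y -> commute x y -> is_cyclic (generated [set x; y]).
Proof.
split=> [eqE x y nxy cxy | cyc].
  by have /edges_adj[] : edges (EPow G) [set x; y] by rewrite eqE edges_adj.
apply/seteqP; split=> _ [x [y [[nxy Exy] ->]]]; apply/edges_adj; split=> //.
  exact: cyclic_commute.
exact: cyc.
Qed.

(** * Products of two cyclic groups inside a group *)

(* For [d = 0] this is the infinite cyclic group. *)
Definition cyclic_mod (K : groupType) (d : int) :=
  exists a : K, (forall g, exists n, g = zpow a n) /\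
                (forall n, zpow a n = 1 <-> (d %| n)%Z).

Lemma zpow_to_multiplicative (V : zmodType) (a : V) n :
  zpow (a : Algebra.to_multiplicative V) n = (a *~ n)%R.
Proof.
elim/int_rect: n => [//|n IHn|n IHn].
  by rewrite -addn1 PoszD zpowS IHn mulrzDr.
by rewrite -addn1 PoszD opprD zpowB1 IHn mulrzBr.
Qed.

Lemma cyclic_mod_Zgrp : cyclic_mod Zgrp 0.
Proof.
exists (1%R : int); split=> [g | n]; last first.
  by rewrite zpow_to_multiplicative intz dvd0z; split=> /eqP.
by exists g; rewrite zpow_to_multiplicative intz.
Qed.

Lemma cyclic_mod_Cgrp p : prime p -> cyclic_mod (Cgrp p) p.
Proof.
move=> p_pr; exists (1%R : 'Z_p); split=> [g | n].
  by exists (Posz (g : 'Z_p)); rewrite zpow_to_multiplicative -pmulrn natr_Zp.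
(* Primality gives [p > 1], so ['Z_p] has characteristic [p] and the default value ['Z_2] does not
   interfere. *)
have chZp: p \in [pchar 'Z_p]%R by rewrite inE p_pr pchar_Zp ?prime_gt1 /=.
by rewrite zpow_to_multiplicative (dvdz_pcharf chZp); split=> /eqP.
Qed.

(** The map sending (a^m, b^n) to x^m y^n is well defined and injective because the relations
    between [x] and [y] are exactly those imposed by the moduli [c] and [d]. *)
Lemma prod_embedding (G A B : groupType) (c d : int) (x y : G) :
  cyclic_mod A c -> cyclic_mod B d -> commute x y ->
  (forall m n, zpow x m * zpow y n = 1 <-> (c %| m)%Z /\ (d %| n)%Z) ->
  has_subgroup_isomorphic_to G (A * B)%type.
Proof.
(* The chosen exponents [r] and [s] are additive only modulo [c] and [d]; [xM] and [yM] show that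
   this is enough once they are applied to [x] and [y]. *)
move=> [a [/choice[r def_r] oa]] [b [/choice[s def_s] ob]] cxy xy1.
have xm m : zpow x m = 1 <-> zpow a m = 1.
  by rewrite oa; have:= xy1 m 0%R; rewrite mulg1 dvdz0 => ->; split=> // -[].
have yn n : zpow y n = 1 <-> zpow b n = 1.
  by rewrite ob; have:= xy1 0%R n; rewrite mul1g dvdz0 => ->; split=> // -[].
have eqz (H K : groupType) (u : H) (v : K) :
    (forall k, zpow u k = 1 <-> zpow v k = 1) ->
    forall m n, zpow v m = zpow v n -> zpow u m = zpow u n.
  move=> uv m n eq_v; rewrite -(subrK n m) zpowD.
  by rewrite (uv _).2 ?mul1g // zpowD zpowN eq_v mulgV.
have xM g h : zpow x (r (g * h)) = zpow x (r g) * zpow x (r h).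
  by rewrite -zpowD; apply: (eqz _ _ x a xm); rewrite zpowD -!def_r.
have yM g h : zpow y (s (g * h)) = zpow y (s g) * zpow y (s h).
  by rewrite -zpowD; apply: (eqz _ _ y b yn); rewrite zpowD -!def_s.
pose f (g : A * B) := zpow x (r g.1) * zpow y (s g.2).
have fM : {morph f : g h / g * h}.
  case=> [g1 g2] [h1 h2]; rewrite /f /= xM yM !mulgA; congr (_ * _).
  by rewrite -!mulgA; congr (_ * _); apply: commute_zpow.
have f1 : f 1 = 1 by apply: (@mulgI _ (f 1)); rewrite -fM !mulg1.
have fV g : f g^-1 = (f g)^-1 by apply/esym/mulg1_eq; rewrite -fM mulgV.
have f_ker g : f g = 1 -> g = 1.
  case: g => g h /xy1[/oa ag /ob bh].
  by rewrite (def_r g) (def_s h) ag bh.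
exists (range f); split.
  split; first by exists 1.
    by move=> _ _ [g _ <-] [h _ <-]; exists (g * h); rewrite ?fM.
  by move=> _ [g _ <-]; exists g^-1; rewrite ?fV.
exists f; split=> // g h eq_f; rewrite -[h]mul1g -[g](mulgVK h); congr (_ * _).
by apply: f_ker; rewrite fM fV eq_f mulgV.
Qed.

Lemma prod_cyclic_obstruction (G A B : groupType) (c d : int) :
  cyclic_mod A c -> cyclic_mod B d -> (d %| c)%Z -> ~~ (d %| 1)%Z ->
  has_subgroup_isomorphic_to G (A * B)%type ->
  exists x y : G, [/\ x <> y, commute x y & ~ is_cyclic (generated [set x; y])].
Proof.
move=> [a [gen_a oa]] [b [gen_b ob]] d_c d_neq1 [H [sgH [f [fM f_inj def_H]]]].
have prod_zpow (g : (A * B)%type) n : zpow g n = (zpow g.1 n, zpow g.2 n).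
  rewrite -(@morph_zpow (A * B)%type A fst) // -(@morph_zpow (A * B)%type B snd) //.
  exact: surjective_pairing.
have b_neq1 : b <> 1 by move/(ob 1%R); apply/negP.
have fX (g : (A * B)%type) n := morph_zpow fM g n.
have f1 : f 1 = 1 by rewrite -[1](zpow0 1) fX.
exists (f (a, 1)), (f (1, b)); split.
- by case/f_inj=> _ /esym.
- by rewrite /commute -!fM; congr f; congr (_, _); rewrite /= ?mulg1 ?mul1g.
case=> g; rewrite generated1 => def_g.
have memH : generated [set f (a, 1); f (1, b)] `<=` H.
  by apply: generated_sub => // _ [] ->; rewrite -def_H; eexists.
(* A generator [g] of the supposed cyclic group lies in the image of [f], and [c] kills both factors
   since [d] divides [c]. *)
have gc : zpow g c = 1.
  have: H g by apply: memH; rewrite def_g; exists 1%R.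
  rewrite -def_H => -[[h k] _ <-]; rewrite -fX prod_zpow /= -f1; congr f.
  have [[m ->] [n ->]] := (gen_a h, gen_b k).
  have am : zpow a (m * c)%R = 1 by apply: (oa _).2; apply: dvdz_mull.
  have bn : zpow b (n * c)%R = 1 by apply: (ob _).2; apply: dvdz_mull.
  by rewrite -!zpowM am bn.
have := @generatedl G (f (a, 1)) (f (1, b)).
have := @generatedr G (f (a, 1)) (f (1, b)).
rewrite def_g => -[j _ gj] [i _ gi].
(* Both sides are g^(ij). Comparing first coordinates gives a^j = 1, so [c] divides [j] and g^j, the
   image of (1, b), is trivial. *)
have: f (zpow (a, 1) j) = f (zpow (1, b) i).
  by rewrite !fX -gi -gj -!zpowM mulrC.
move/f_inj; rewrite !prod_zpow /= !zpow1n => -[/oa c_j _].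
apply: b_neq1; suff: (1, b) = 1 :> (A * B)%type by case.
by apply: f_inj; rewrite f1 -gj; apply: zpow_dvd gc.
Qed.

(** * Change of basis for a commuting pair *)

(** For commuting elements, substitution acts on exponent vectors as a 2 by 2 integer matrix; this
    serves to invert the change of basis below. *)
Lemma zpow_pair (G : groupType) (u v : G) a b c d m n : commute u v ->
  zpow (zpow u a * zpow v b) m * zpow (zpow u c * zpow v d) n =
  zpow u (a * m + c * n)%R * zpow v (b * m + d * n)%R.
Proof.
move=> cuv; rewrite !zpowMg; do ?exact: commute_zpow.
rewrite !zpowD !zpowM !mulgA; congr (_ * _); rewrite -!mulgA; congr (_ * _).
by rewrite -!zpowM; apply/commute_sym/commute_zpow.
Qed.

(* Writing [(i, j) = g (i', j')] with [g = gcd(i, j)], the primitive vector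
   [(i', j')] extends to a basis of Z^2, and its image in G is killed by [g]. *)
Lemma relation_basis (G : groupType) (u v : G) i j :
  commute u v -> zpow u i * zpow v j = 1 -> gcdz i j <> 0%R ->
  exists u1 v1, [/\ commute u1 v1,
    generated [set u1; v1] = generated [set u; v] & zpow u1 (gcdz i j) = 1].
Proof.
have [r [s def_g]] := Bezoutz i j; move: (dvdz_gcdl i j) (dvdz_gcdr i j).
set g := gcdz i j in def_g * => /dvdzP[i' def_i] /dvdzP[j' def_j].
move=> cuv uv1 /eqP g_neq0.
have def1 : (r * i' + s * j' = 1)%R.
  by apply: (mulIf g_neq0); rewrite mul1r mulrDl -!mulrA -def_i -def_j.
(* The matrix with rows (i', j') and (-s, r) has determinant 1 by [def1]; [def_u] and [def_v] are
   read off from its inverse. *)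
pose u1 := zpow u i' * zpow v j'; pose v1 := zpow u (- s)%R * zpow v r.
have cuv1 : commute u1 v1.
  have cvu := commute_sym cuv.
  apply: commuteM; apply/commute_sym/commuteM;
    do ?[exact: commute_zpow]; exact/commute_zpow/commute_refl.
have def_u : u = zpow u1 r * zpow v1 (- j')%R.
  rewrite zpow_pair // mulrNN [(i' * r)%R]mulrC [(j' * r)%R]mulrC def1.
  by rewrite mulrN subrr mulg1.
have def_v : v = zpow u1 s * zpow v1 i'.
  rewrite zpow_pair // mulNr [(i' * s)%R]mulrC subrr mul1g addrC.
  by rewrite [(j' * s)%R]mulrC def1.
exists u1, v1; split=> //.
  apply: eq_generated => _ [] ->; rewrite -1?/u1 -1?/v1.
  - exact: generated_pair_zpow.
  - exact: generated_pair_zpow.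
  - by rewrite def_u; apply: generated_pair_zpow.
  by rewrite [X in _ X]def_v; apply: generated_pair_zpow.
by rewrite /u1 zpowMg; [rewrite -!zpowM -def_i -def_j | exact: commute_zpow].
Qed.

(** * Embeddings built from an element of prime order *)

Lemma infinite_order_embedding (G : groupType) (w v : G) (p : nat) :
  prime p -> commute v w -> w <> 1 -> zpow w p = 1 ->
  (forall n, zpow v n = 1 -> n = 0%R) ->
  has_subgroup_isomorphic_to G (Zgrp * Cgrp p)%type.
Proof.
move=> p_pr cvw w_neq1 wp1 v_free.
apply: (prod_embedding cyclic_mod_Zgrp (cyclic_mod_Cgrp p_pr) cvw) => m n.
rewrite dvd0z; split=> [vw1 | [/eqP-> p_n]]; last first.
  by rewrite (zpow_dvd p_n wp1) mulg1.
have m0 : m = 0%R.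
  (* Raising the relation to the power [p] removes [w] and leaves v^(mp) = 1. *)
  have: zpow (zpow v m * zpow w n) p = 1 by rewrite vw1 zpow1n.
  rewrite zpowMg; last exact: commute_zpow.
  rewrite -!zpowM [(n * p)%R]mulrC [zpow w _]zpowM wp1 zpow1n mulg1.
  move/v_free/eqP; rewrite mulf_eq0 => /orP[/eqP // | /eqP[p0]].
  by rewrite p0 in p_pr.
rewrite m0 eqxx; split=> //; apply: zpow_prime w_neq1 wp1 _ => //.
by rewrite m0 mul1g in vw1.
Qed.

Lemma prime_order_embedding (G : groupType) (w v : G) (p : nat) :
  prime p -> commute w v -> w <> 1 -> zpow w p = 1 -> v <> 1 -> zpow v p = 1 ->
  (forall n, w <> zpow v n) ->
  has_subgroup_isomorphic_to G (Cgrp p * Cgrp p)%type.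
Proof.
move=> p_pr cwv w_neq1 wp1 v_neq1 vp1 w_notin.
have Kp := cyclic_mod_Cgrp p_pr.
apply: (prod_embedding Kp Kp cwv) => m n; split=> [wv1 | [p_m p_n]]; last first.
  by rewrite (zpow_dvd p_m wp1) (zpow_dvd p_n vp1) mulg1.
have p_m : (p %| m)%Z.
  apply/idPn => p'm; have [a [b def1]] := Bezoutz p m.
  have g1 : gcdz p m = 1%R.
    by congr Posz; apply/eqP; rewrite -[_ == _]/(coprime p `|m|) prime_coprime.
  have wm : zpow w m = zpow v (- n)%R.
    by rewrite zpowN; apply/eqP; rewrite -mulg_eq1 wv1.
  (* Here [b] inverts [m] modulo [p], so w = w^(mb) = v^(-nb), a power of [v]. *)
  case: (w_notin (- n * b)%R); rewrite zpowM -wm -zpowM.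
  rewrite -{1}[w]zpow1 -g1 -def1 zpowD.
  by rewrite (zpow_dvd (dvdz_mull a (dvdzz p)) wp1) mul1g mulrC.
split=> //; apply: zpow_prime v_neq1 vp1 _ => //.
by rewrite (zpow_dvd p_m wp1) mul1g in wv1.
Qed.

(** * Commuting pairs when the three kinds of product are excluded *)

Section CommutingPairs.
Variable G : groupType.
Hypothesis noZZ : ~ has_subgroup_isomorphic_to G (Zgrp * Zgrp)%type.
Hypothesis noZC : forall p, prime p ->
  ~ has_subgroup_isomorphic_to G (Zgrp * Cgrp p)%type.
Hypothesis noCC : forall p, prime p ->
  ~ has_subgroup_isomorphic_to G (Cgrp p * Cgrp p)%type.

(** Without a nonzero relation, [prod_embedding] with both moduli 0 would embed the excluded
    product. The nonvanishing gcd says that (i, j) is nonzero, in the form that [relation_basis]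
    takes. *)
Lemma commute_relation (x y : G) : commute x y ->
  exists i j, zpow x i * zpow y j = 1 /\ gcdz i j <> 0%R.
Proof.
move=> cxy; apply: contrapT => no_rel; apply: noZZ.
apply: (prod_embedding cyclic_mod_Zgrp cyclic_mod_Zgrp cxy) => m n.
rewrite !dvd0z; split=> [xy1 | [/eqP-> /eqP->]]; last by rewrite mulg1.
apply: contrapT => mn_neq0; apply: no_rel; exists m, n; split=> // g0.
by apply/mn_neq0/andP; rewrite -gcdz_eq0 g0.
Qed.

Lemma commute_cyclic (x y : G) : commute x y -> is_cyclic (generated [set x; y]).
Proof.
move=> cxy.
pose basis (u v : G) := commute u v /\ generated [set u; v] = generated [set x; y].
pose P (d : nat) := 0 < d /\ exists u v, basis u v /\ zpow u d = 1.
(* Any nonzero relation on any basis makes its gcd a candidate for [P]; this yields both the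
   existence of a minimal [d] and the lower bound on gcds. *)
have basis_rel u v i j : basis u v -> zpow u i * zpow v j = 1 ->
    gcdz i j <> 0%R -> P (gcdn `|i| `|j|).
  move=> [cuv def_uv] uv1 g_neq0.
  have [u1 [v1 [cuv1 def_uv1 u1g]]] := relation_basis cuv uv1 g_neq0.
  split; last by exists u1, v1; split=> //; split; rewrite // def_uv1.
  by rewrite lt0n; apply/eqP=> g0; apply: g_neq0; rewrite /gcdz g0.
have exP : exists d, `[< P d >].
  have [i [j [xy1 g_neq0]]] := commute_relation cxy.
  by exists (gcdn `|i| `|j|); apply/asboolP; exact: basis_rel xy1 g_neq0.
case: (ex_minnP exP) => d /asboolP[d_gt0 [u [v [[cuv def_uv] ud1]]]] min_d.
have {}min_d i j : zpow u i * zpow v j = 1 -> gcdz i j <> 0%R ->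
  d <= gcdn `|i| `|j|.
  by move=> uv1 g_neq0; apply/min_d/asboolP; exact: basis_rel uv1 g_neq0.
have [d_le1 | d_gt1] := leqP d 1.
  have d1 : d = 1%N by apply/eqP; rewrite eqn_leq d_le1.
  have u1 : u = 1 by rewrite d1 in ud1.
  exists v; rewrite -def_uv u1; apply: eq_generated => z.
    case=> ->; last exact: mem_generated.
    by have [] := generated_subgroup [set v].
  by move=> ->; apply: generatedr.
exfalso; pose p := pdiv d; have p_pr : prime p by apply: pdiv_prime.
have p_d : (p %| d)%N by apply: pdiv_dvd.
pose k := (d %/ p)%N; have def_d : d = (k * p)%N by rewrite divnK.
have k_gt0 : 0 < k by move: d_gt0; rewrite def_d muln_gt0 => /andP[].
have k_lt_d : k < d by rewrite def_d ltn_Pmulr ?prime_gt1.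
pose w := zpow u k.
have wp1 : zpow w p = 1 by rewrite /w -zpowM -PoszM -def_d.
have w_notin n : w <> zpow v n.
  (* If w = v^n, then (k, -n) is a relation whose gcd divides [k], hence is smaller than [d]. *)
  move=> def_w; have := @min_d k (- n)%R.
  rewrite zpowN -def_w mulgV leqNgt => min_k; suff /min_k: gcdz k (- n) <> 0%R.
    move=> /(_ erefl); apply/negP/negPn; apply: leq_ltn_trans k_lt_d.
    by rewrite dvdn_leq ?dvdn_gcdl.
  by apply/eqP; rewrite gcdz_eq0 negb_and -absz_gt0 k_gt0.
have w_neq1 : w <> 1 by apply: (w_notin 0%R).
have cvw : commute v w by apply: (@commute_zpow _ v u 1%R); apply: commute_sym.
have [v_free | ] := pselect (forall n, zpow v n = 1 -> n = 0%R).
  exact: noZC (infinite_order_embedding p_pr cvw w_neq1 wp1 v_free).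
(* The least positive exponent [e] killing [v] is its order. *)
move=> /existsNP[n /not_implyP[vn1 n_neq0]]; pose Q e := 0 < e /\ zpow v (Posz e) = 1.
have exQ : exists e, `[< Q e >].
  exists `|n|%N; apply/asboolP; split; first by rewrite absz_gt0; apply/eqP.
  by apply: zpow_dvd vn1; rewrite dvdzE.
case: (ex_minnP exQ) => e /asboolP[e_gt0 ve1] min_e.
have d_e : (d %| e)%N.
  have: d <= gcdn d e.
    apply: (@min_d d e); first by rewrite ud1 ve1 mulg1.
    by apply/eqP; rewrite gcdz_eq0 negb_and -absz_gt0 d_gt0.
  by move=> le_d; apply/gcdn_idPl/eqP; rewrite eqn_leq le_d dvdn_leq ?dvdn_gcdl.
have p_e : (p %| e)%N := dvdn_trans p_d d_e.
pose v' := zpow v (e %/ p)%N.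
apply: (noCC p_pr); apply: (@prime_order_embedding _ w v' p) => //.
- exact/commute_sym/(@commute_zpow _ v w _ 1%R).
(* If [v'] were trivial, the smaller positive exponent e/p would kill [v]. *)
- move=> v'1; have: e <= e %/ p.
    by apply: min_e; apply/asboolP; split; rewrite // divn_gt0 ?prime_gt0 // dvdn_leq.
  by rewrite leqNgt ltn_Pdiv ?prime_gt1.
- by rewrite /v' -zpowM -PoszM divnK.
by move=> m; rewrite /v' -zpowM; apply: w_notin.
Qed.

End CommutingPairs.

Theorem theorem2 (G : groupType) :
  edges (EPow G) = edges (Com G) <->
  ~ has_subgroup_isomorphic_to G (Zgrp * Zgrp)%type /\
  (forall p : nat, prime p ->
     ~ has_subgroup_isomorphic_to G (Zgrp * Cgrp p)%type /\
     ~ has_subgroup_isomorphic_to G (Cgrp p * Cgrp p)%type).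
Proof.
rewrite edges_EPow_ComP; split=> [cyc | [noZZ noC] x y _]; last first.
  by apply: commute_cyclic => // p /noC[].
(* The three cases take (c, d) to be (0, 0), (0, p) and (p, p); each time [d] divides [c] and is not
   a unit. *)
have no_prod (A B : groupType) (c d : int) :
    cyclic_mod A c -> cyclic_mod B d -> (d %| c)%Z -> ~~ (d %| 1)%Z ->
    ~ has_subgroup_isomorphic_to G (A * B)%type.
  move=> Ac Bd d_c d_neq1 sAB.
  have [x [y [nxy cxy]]] := prod_cyclic_obstruction Ac Bd d_c d_neq1 sAB.
  by apply; apply: cyc.
split=> [|p p_pr]; first exact: (no_prod _ _ _ _ cyclic_mod_Zgrp cyclic_mod_Zgrp).
have p_neq1 : ~~ (p %| 1)%Z by rewrite dvdz1 /= neq_ltn prime_gt1 ?orbT.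
have Cp := cyclic_mod_Cgrp p_pr.
by split; [apply: (no_prod _ _ _ _ cyclic_mod_Zgrp Cp) | apply: (no_prod _ _ _ _ Cp Cp)].
Qed.
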